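(* Let $\nu\in\mathbb{R}$ and $t>0$. For every $n\in\mathbb{N}_0$, $$A_{n+1}^2(t)+ B_n^2(t)+ A_n^2(t)- (2n+\nu+2)B_n(t) + 2\frac{b_n(t)}{a_n(t)} - t=0,$$ and for every $n\in\mathbb{N}$, $$A^2_n(t) \left[B_n(t)-\nu-1-2n\right] \left[ B_{n-1}(t)-\nu+1-2n\right] - \left[ A_n^2(t) + \frac{b_n(t)}{a_n(t)} \right]^2+ t \left[ A_n^2(t) + \frac{b_n(t)}{a_n(t)} \right] = 0,$$ $$t \,\frac{d}{dt}\left[ B_{n-1}(t) + B_n(t) \right] + \left[ B_{n-1}(t) + B_n(t) \right] \left[ B_{n-1}(t) - B_n(t) +1\right] - (2n+\nu) \left[ B_{n-1}(t) - B_n(t) \right] =0.$$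
   Context: $\mathbb{N}=\{1,2,\dots\}$, $\mathbb{N}_0=\{0,1,2,\dots\}$. For $\nu\in\mathbb{R}$, $t>0$, $\{P_n^\nu(x,t)\}_{n\ge 0}$ is the sequence of polynomials in $x$ with $P_n^\nu$ of degree exactly $n$ and $\int_0^\infty P_n^\nu(x,t)P_m^\nu(x,t)e^{-x-t/x}x^\nu dx=\delta_{n,m}$ for $n,m\in\mathbb{N}_0$; the sign is fixed so that the leading coefficient has sign $(-1)^n$. Write $P_n^\nu(x,t)=\sum_{k=0}^n a_{n,k}(t)x^k$, $a_n(t)=a_{n,n}(t)\neq0$, $b_n(t)=a_{n,n-1}(t)$ (with $b_0=0$). Put $A_n(t)=a_{n-1}(t)/a_n(t)$ for $n\ge1$, $A_0=0$, and $B_n(t)=\frac{b_n(t)}{a_n(t)}-\frac{b_{n+1}(t)}{a_{n+1}(t)}$ for $n\ge 0$; these are the coefficients in the three term recurrence $xP_n^\nu=A_{n+1}P_{n+1}^\nu+B_nP_n^\nu+A_nP_{n-1}^\nu$ (with $P_{-1}^\nu\equiv0$). The coefficients $a_{n,k}(t)$ are regarded as continuously differentiable functions of $t>0$. *)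

(* Defs.v *)
From mathcomp Require Import all_boot all_order all_algebra.
From mathcomp Require Import all_classical all_reals all_analysis.
Set Implicit Arguments.
Unset Strict Implicit.
Unset Printing Implicit Defensive.
Import Order.TTheory GRing.Theory Num.Theory.
Import numFieldNormedType.Exports.
Local Open Scope classical_set_scope.
Local Open Scope ring_scope.

Definition weight (R : realType) (nu t x : R) : R :=
  expR (- x - t / x) * x `^ nu.

(* [P n t] is the polynomial $P_n^\nu(\cdot,t)$; its values at t <= 0 are
   irrelevant.  The integral is extended-real valued and equals -oo when both
   the positive and the negative part of the integrand have infinite integral,
   so the orthonormality equation includes the convergence of the integral. *)
Definition orthonormal_family (R : realType) (nu : R)
    (P : nat -> R -> {poly R}) : Prop :=
  forall t : R, 0 < t ->
    (forall n : nat, size (P n t) = n.+1 /\ 0 < (-1) ^+ n * lead_coef (P n t))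
    /\
    (forall n m : nat,
       (\int[@lebesgue_measure R]_(x in `]0%R, +oo[)
          ((P n t).[x] * (P m t).[x] * weight nu t x)%R%:E)%E
       = ((n == m)%:R)%:E).

Definition acoef (R : realType) (P : nat -> R -> {poly R}) (n : nat) (t : R) : R :=
  (P n t)`_n.

Definition bcoef (R : realType) (P : nat -> R -> {poly R}) (n : nat) (t : R) : R :=
  if n is m.+1 then (P n t)`_m else 0.

Definition Acoef (R : realType) (P : nat -> R -> {poly R}) (n : nat) (t : R) : R :=
  if n is m.+1 then acoef P m t / acoef P n t else 0.

Definition Bcoef (R : realType) (P : nat -> R -> {poly R}) (n : nat) (t : R) : R :=
  bcoef P n t / acoef P n t - bcoef P n.+1 t / acoef P n.+1 t.

(* Main.v *)
From HB Require Import structures.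
Require Import Defs.
From mathcomp Require Import all_boot all_order all_algebra.
From mathcomp Require Import all_classical all_reals all_analysis.
From mathcomp Require Import measurable_realfun lebesgue_Rintegral.
From mathcomp Require Import ring lra.
Import Order.TTheory GRing.Theory Num.Theory.
Import numFieldNormedType.Exports.
Local Open Scope classical_set_scope.
Local Open Scope ring_scope.

(** Put [w(x) = x^nu e^(-x-t/x)], and let [Lam q] be the integral of [q w / x]
    over the half-line, so that the [P_n] are orthonormal for the pairing
    [Lam (x q1 q2)].  Integrating the derivative of [x q w] gives the Pearson
    identity

      [Lam (x^2 q') + (nu + 1) Lam (x q) - Lam (x^2 q) + t Lam q = 0].

    For [q = P_n^2] and [q = P_(n+1) P_n] orthogonality evaluates all terms
    but the last ([rcoef_Lam], [Zcoef_Lam]):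

      [r_n := B_n - nu - 1 - 2 n = t Lam (P_n^2)],
      [Z_n := A_n^2 + b_n / a_n = t A_n Lam (P_n P_(n-1))].

    In [Lam (P_n P_m)] with [m <= n] one may replace a factor by its constant
    term and control the error by orthogonality.  So these integrals are
    products of the numbers [P_n(0)] and [Lam P_n], up to one explicit
    correction, and comparing products yields the second equation in the form
    [A_n^2 r_n r_(n-1) = Z_n (Z_n - t)] ([discrete_second]).  Applying [t Lam]
    to the three-term recurrence multiplied by [P_n] yields the first equation
    in the form [Z_(n+1) + Z_n = t - B_n r_n] ([discrete_first]).

    Given these, the third equation follows from the Toda equation
    [t B_n' = Z_n - Z_(n+1)].  It is proved by induction on [n], without
    differentiating the polynomials.  Since [r_n] is not zero ([rcoef_neq0]),
    the two discrete equations express [A_(n+1)^2] and [B_(n+1)] rationally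
    through the quantities of index [n].  Hence differentiability propagates,
    and the Toda equations propagate by algebra ([toda_equations]).  The start of the
    induction is a Riccati equation for [B_0], a quotient of two moments of
    [w]; it follows from the recursion between the moments and from their
    derivatives in [t] ([moment_rec], [is_derive_moment], [riccati_B0]). *)

(** * Moments of the weight on the half-line *)

Section Moments.
Context {R : realType}.
Implicit Types s t x : R.

Lemma weight_ge0 s t x : 0 <= weight s t x.
Proof. by rewrite mulr_ge0 ?expR_ge0 ?powR_ge0. Qed.

Lemma mul_weight s t x : 0 < x -> x * weight s t x = weight (s + 1) t x.
Proof.
move=> x0; rewrite /weight powRD ?(gt_eqF x0) ?implybT// powRr1 ?ltW//; ring.
Qed.

(** The tangent line of the logarithm at [1/e]; letting [e] vary bounds the
    logarithm by an arbitrarily small multiple of its argument. *)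
Lemma ln_le_tangent e x : 0 < e -> 0 < x -> ln x <= e * x - ln e - 1.
Proof.
move=> e0 x0; have := @le_ln1Dx R (e * x - 1).
rewrite addrCA subrr addr0 lnM ?posrE// => /(_ _); rewrite ltrBrDl subrr mulr_gt0//.
by move/(_ isT); lra.
Qed.

(** The exponent is [s ln x - x - t/x]; the term [x] absorbs [s ln x] when
    [s > 0], and [t/x] absorbs it when [s < 0].  As [s] is arbitrary,
    this one bound gives decay of every order at [0] and at infinity. *)
Lemma weight_bounded s t : 0 < t ->
  exists C, 0 < C /\ forall x, 0 < x -> weight s t x <= C.
Proof.
move=> t0; suff [K HK] : exists K, forall x, 0 < x -> s * ln x - x - t / x <= K.
  exists (expR K); split=> [|x x0]; first exact: expR_gt0.
  by rewrite /weight /powR (gt_eqF x0) -expRD ler_expR; have := HK x x0; lra.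
case: (ltrgt0P s) => [s0|s0|->].
(* [ln_le_tangent] with slope [1/s], so that [s ln x <= x + const]. *)
- exists (s * (- ln s^-1 - 1)) => x x0.
  have H := ln_le_tangent (s^-1) x; rewrite invr_gt0 in H.
  have /(_ s0 x0) {}H := H.
  have : s * ln x <= s * (s^-1 * x - ln s^-1 - 1) by rewrite ler_pM2l.
  have -> : s * (s^-1 * x - ln s^-1 - 1) = x + s * (- ln s^-1 - 1).
    by field; rewrite gt_eqF.
  have : 0 < t / x by rewrite divr_gt0.
  lra.
- have s0' : 0 < - s by lra.
  (* [ln_le_tangent] at [1/x] with slope [t/(-s)], so that
     [s ln x <= t/x + const]. *)
  exists (- s * (- ln (t / - s) - 1)) => x x0.
  have H : ln x^-1 <= t / - s * x^-1 - ln (t / - s) - 1.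
    by apply: ln_le_tangent; rewrite ?invr_gt0// divr_gt0.
  have : - s * ln x^-1 <= - s * (t / - s * x^-1 - ln (t / - s) - 1).
    by rewrite ler_pM2l.
  have -> : - s * (t / - s * x^-1 - ln (t / - s) - 1) =
       t / x + - s * (- ln (t / - s) - 1).
    by field; rewrite (gt_eqF x0) (lt_eqF s0).
  rewrite lnV ?posrE//; lra.
- exists 0 => x x0; have : 0 < t / x by rewrite divr_gt0.
  lra.
Qed.

Lemma is_derive_weight s t x : 0 < x ->
  is_derive x 1 (weight s t)
    (s * weight (s - 1) t x - weight s t x + t * weight (s - 2) t x).
Proof.
move=> x0; rewrite /weight.
have xn0 : x != 0 by rewrite gt_eqF.
have Hp := is_derive1_powR s x0.
have Hi : is_derive x 1 (fun y : R => y^-1) (- x ^- 2 *: 1).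
  by apply: is_deriveV.
apply: (@is_derive_eq _ _ _ _ _ _ _) .
rewrite /GRing.scale /=.
rewrite !powRB ?xn0 ?implybT// powRr1 ?ltW// powR_mulrn ?ltW//.
by field.
Qed.

Lemma is_derive_weight_t s t x : 0 < x ->
  is_derive t 1 (weight s ^~ x) (- weight (s - 1) t x).
Proof.
move=> x0; rewrite /weight.
have xn0 : x != 0 by rewrite gt_eqF.
apply: (@is_derive_eq _ _ _ _ _ _ _).
rewrite /GRing.scale /= !powRB ?xn0 ?implybT// powRr1 ?ltW//.
by field.
Qed.

Lemma weight_continuous s t x : 0 < x -> {for x, continuous (weight s t)}.
Proof.
move=> x0; apply: differentiable_continuous; apply/derivable1_diffP.
by have [] := is_derive_weight s t x x0.
Qed.

Local Notation D := (`]0%R, +oo[%classic : set R).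
Local Notation mu := (@lebesgue_measure R).

Lemma measurable_weight s t : measurable_fun D (weight s t).
Proof.
apply: open_continuous_measurable_fun; first exact: interval_open.
by move=> x; rewrite inE /= in_itv /= andbT; exact: weight_continuous.
Qed.

(** The weights of exponents [s] and [s + 2] are bounded, hence
    [(1 + x^2) * weight s t x] is, and [1 / (1 + x^2)] is integrable. *)
Lemma integrable_weight s t : 0 < t -> mu.-integrable D (EFin \o weight s t).
Proof.
move=> t0; have [C [C0 HC]] := weight_bounded s t t0.
have [C' [C'0 HC']] := weight_bounded (s + 1 + 1) t t0.
apply: (@le_integrable _ _ _ mu D _ _ (EFin \o (fun x => (C + C') * (oneDsqr x)^-1))).
- exact: measurable_itv.
- by apply/measurable_EFinP; exact: measurable_weight.
- move=> x; rewrite /= in_itv /= andbT => x0.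
  rewrite lee_fin ger0_norm ?weight_ge0// ger0_norm; last first.
    rewrite divr_ge0 ?addr_ge0 ?(ltW C0) ?(ltW C'0)//.
    exact: sqr_ge0.
  rewrite ler_pdivlMr ?oneDsqr_gt0//.
  have -> : weight s t x * oneDsqr x = weight s t x + x * (x * weight s t x).
    by rewrite /oneDsqr; ring.
  by rewrite !mul_weight// lerD ?HC ?HC'.
- rewrite (_ : _ \o _ = (fun x => (C + C')%:E * ((oneDsqr x)^-1)%:E)%E)//.
  apply: integrableZl; first exact: measurable_itv.
  apply/integrableP; split.
    apply/measurable_EFinP; apply: open_continuous_measurable_fun.
      exact: interval_open.
    by move=> x _; exact: continuous_oneDsqrV.
  under eq_integral do
    rewrite gee0_abs ?lee_fin ?invr_ge0 ?(le_trans ler01) ?oneDsqr_ge1//.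
  rewrite integral_itv_obnd_cbnd; last first.
    apply/measurable_EFinP; apply: open_continuous_measurable_fun.
      exact: interval_open.
    by move=> x _; exact: continuous_oneDsqrV.
  by rewrite integral0y_oneDsqr ltry.
Qed.

Definition moment s t : R := \int[mu]_(x in D) weight s t x.

(** The integrand of the left-hand side is the derivative of [weight s t],
    which vanishes at [0] and at infinity.  The integral over the half-line
    is the limit, by dominated convergence, of the integrals over the
    intervals [[1/(n+2), n+2]], to which the fundamental theorem of calculus
    applies. *)
Lemma moment_rec s t : 0 < t ->
  s * moment (s - 1) t - moment s t + t * moment (s - 2) t = 0.
Proof.
move=> t0; have mD : measurable D by exact: measurable_itv.
have ID s' := integrable_weight s' t t0.
pose g x := s * weight (s - 1) t x - weight s t x + t * weight (s - 2) t x.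
have Ig1 : mu.-integrable D (EFin \o (fun x => s * weight (s - 1) t x)).
  rewrite (_ : _ \o _ = (fun x => s%:E * (EFin \o weight (s - 1) t) x)%E)//.
  exact: integrableZl.
have Ig3 : mu.-integrable D (EFin \o (fun x => t * weight (s - 2) t x)).
  rewrite (_ : _ \o _ = (fun x => t%:E * (EFin \o weight (s - 2) t) x)%E)//.
  exact: integrableZl.
have Ig2 : mu.-integrable D (EFin \o (fun x => s * weight (s - 1) t x - weight s t x)).
  rewrite (_ : _ \o _ = ((EFin \o (fun x => (s * weight (s - 1) t x)%R))
    \- (EFin \o weight s t))%E)//.
  exact: integrableB.
have Ig : mu.-integrable D (EFin \o g).
  rewrite (_ : _ \o _ =
    ((EFin \o (fun x => (s * weight (s - 1) t x - weight s t x)%R))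
    \+ (EFin \o (fun x => (t * weight (s - 2) t x)%R)))%E)//.
  exact: integrableD.
rewrite /moment -!RintegralZl// -RintegralB// -RintegralD//.
suff : (\int[mu]_(x in D) (g x)%:E = 0)%E by rewrite /Rintegral => ->.
have gc x : 0 < x -> {for x, continuous g}.
  move=> x0; rewrite /g; apply: cvgD.
    by apply: cvgB; [apply: cvgM; [exact: cvg_cst|]|]; exact: weight_continuous.
  by apply: cvgM; [exact: cvg_cst|]; exact: weight_continuous.
pose I n : set R := `[(n.+2%:R)^-1, n.+2%:R]%classic.
have I0 n : (0 : R) < (n.+2%:R)^-1 by rewrite invr_gt0.
have ID' n x : I n x -> 0 < x.
  by rewrite /I /= in_itv /= => /andP[+ _]; exact: lt_le_trans.
pose f (n : nat) (x : R) : \bar R := ((g \_ (I n)) x)%:E.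
have mg : measurable_fun D (EFin \o g) by case/integrableP : Ig.
have IE n : (\int[mu]_(x in D) f n x = (weight s t n.+2%:R - weight s t n.+2%:R^-1)%:E)%E.
  have -> : (\int[mu]_(x in D) f n x = \int[mu]_(x in D) ((EFin \o g) \_ (I n)) x)%E.
    by apply: eq_integral => x _; rewrite /f /patch /=; case: ifP.
  rewrite -integral_mkcondr.
  have -> : D `&` I n = I n.
    by apply/setIidr => x /ID'; rewrite /= in_itv /= andbT.
  rewrite EFinB; apply: continuous_FTC2.
  - by rewrite (@lt_trans _ _ 1) ?invf_lt1 ?ltr1n.
  - by apply: continuous_in_subspaceT => x; rewrite inE => /ID'; exact: gc.
  - split.
    + move=> x; rewrite in_itv /= => /andP[x1 _].
      by have [] := is_derive_weight s t x (lt_trans (I0 n) x1).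
    + by apply: cvg_at_right_filter; apply: weight_continuous.
    + by apply: cvg_at_left_filter; apply: weight_continuous.
  - move=> x; rewrite in_itv /= => /andP[x1 _].
    by rewrite derive1E; have [_ ->] := is_derive_weight s t x (lt_trans (I0 n) x1).
have mf n : measurable_fun D (f n).
  apply/measurable_EFinP/measurable_restrict => //; first exact: measurable_itv.
  by apply: (measurable_funS mD); [exact: subIsetl|exact/measurable_EFinP].
have fG x n : D x -> (`|f n x| <= `|(EFin \o g) x|)%E.
  by move=> _; rewrite /f /patch /=; case: ifP => _; rewrite lee_fin ?normr0 ?normr_ge0.
have fg x : D x -> f^~ x @ \oo --> (EFin \o g) x.
  rewrite /= in_itv /= andbT => x0; apply: cvg_near_cst; near=> n.
  rewrite /f /patch mem_set//= /I /= in_itv /=; apply/andP; split.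
    rewrite invf_ple ?posrE// (@le_trans _ _ n%:R)//; last first.
      by rewrite ler_nat -addn2 leq_addr.
    by near: n; exact: nbhs_infty_ger.
  rewrite (@le_trans _ _ n%:R)//; last by rewrite ler_nat -addn2 leq_addr.
  by near: n; exact: nbhs_infty_ger.
case: (@dominated_convergence _ _ _ mu D mD f (EFin \o g) (abse \o (EFin \o g))).
- exact: mf.
- exact: mg.
- exact: aeW.
- exact: integrable_abse.
- exact: aeW.
move=> _ _; under eq_fun do rewrite IE.
move=> Hlim; apply: (cvg_unique _ Hlim) => //.
apply: cvg_EFin; first exact: nearW.
rewrite /comp /=.
have [C [C0 HC]] := weight_bounded (s + 1) t t0.
have [C' [C'0 HC']] := weight_bounded (s - 1) t t0.
have bnd n : `|weight s t n.+2%:R - weight s t n.+2%:R^-1| <= (C + C') * n.+2%:R^-1.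
  have n0 : (0 : R) < n.+2%:R by [].
  rewrite (le_trans (ler_normB _ _))// mulrDl !ger0_norm ?weight_ge0// lerD//.
    by rewrite ler_pdivlMr// mulrC mul_weight// HC.
  rewrite ler_pdivlMr// mulrC -[s in weight s](subrK 1) -mul_weight// mulrA.
  rewrite mulfV ?gt_eqF// mul1r.
  by rewrite HC'.
apply: norm_cvg0; apply: (@squeeze_cvgr _ _ _ _ (cst 0) (fun n => (C + C') * harmonic n)).
- near=> n; rewrite normr_ge0 /= (le_trans (bnd n))// ler_wpM2l ?addr_ge0 ?ltW//.
  by rewrite ltf_pV2 ?posrE// ltr_nat.
- exact: cvg_cst.
- rewrite -[0 in X in _ --> X](mulr0 (C + C')).
  by apply: cvgM; [exact: cvg_cst|exact: cvg_harmonic].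
Unshelve. all: by end_near. Qed.

(** Differentiation under the integral sign; for parameters above [t/2] the
    derivatives of the integrand are dominated by [weight (s - 1) (t/2)]. *)
Lemma is_derive_moment s t : 0 < t ->
  is_derive t 1 (moment s) (- moment (s - 1) t).
Proof.
move=> t0; have mD : measurable D by exact: measurable_itv.
have Dgt0 x : D x -> 0 < x by rewrite /= in_itv /= andbT.
have It : `]t / 2, t + 1[%classic t.
  by rewrite /= in_itv /=; apply/andP; split; lra.
have Igt0 u : `]t / 2, t + 1[%classic u -> t / 2 < u.
  by rewrite /= in_itv /= => /andP[].
have d1E u x : 0 < x -> partial1of2 (weight s) u x = - weight (s - 1) u x.
  by move=> x0; rewrite partial1of2E; have [_ ->] := is_derive_weight_t s u x x0.
have iI u : `]t / 2, t + 1[%classic u -> mu.-integrable D (EFin \o weight s u).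
  by move=> /Igt0 u0; apply: integrable_weight; lra.
have dI u x : `]t / 2, t + 1[%classic u -> D x -> derivable (weight s ^~ x) u 1.
  by move=> _ /Dgt0 x0; have [] := is_derive_weight_t s u x x0.
have iG : mu.-integrable D (EFin \o weight (s - 1) (t / 2)).
  by apply: integrable_weight; lra.
have GI u x : `]t / 2, t + 1[%classic u -> D x ->
    `|partial1of2 (weight s) u x| <= weight (s - 1) (t / 2) x.
  move=> /Igt0 u0 /Dgt0 x0; rewrite d1E// normrN ger0_norm ?weight_ge0//.
  rewrite /weight ler_wpM2r ?powR_ge0// ler_expR lerD2l lerN2.
  by rewrite ler_pM2r ?invr_gt0// ltW.
have Hd := @derivable_under_integral R _ _ mu (weight s) D mD t (t / 2) (t + 1)
  It iI dI _ (weight_ge0 _ _) iG GI.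
have He := @differentiation_under_integral R _ _ mu (weight s) D mD t (t / 2)
  (t + 1) It iI dI _ (weight_ge0 _ _) iG GI.
apply: DeriveDef; first exact: Hd.
rewrite -derive1E [LHS]He.
have -> : - moment (s - 1) t = \int[mu]_(x in D) (- 1 * weight (s - 1) t x).
  by rewrite RintegralZl ?mulN1r//; exact: (integrable_weight _ _ t0).
by apply: eq_Rintegral => x; rewrite inE => /Dgt0 x0; rewrite d1E// mulN1r.
Qed.

Definition wint s t (q : {poly R}) : R^o :=
  \int[mu]_(x in D) (q.[x] * weight s t x).

(** Replacing [q] by [q * 'X] amounts to raising the exponent by one, so an
    induction on [q] that leaves [s] free only needs constant polynomials. *)
Lemma integrable_poly_weight s t (q : {poly R}) : 0 < t ->
  mu.-integrable D (EFin \o (fun x => q.[x] * weight s t x)).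
Proof.
move=> t0; have mD : measurable D by exact: measurable_itv.
elim/poly_ind: q s => [|q c IH] s.
  rewrite (_ : _ \o _ = fun=> 0%E); first exact: integrable0.
  by apply/funext => x /=; rewrite horner0 mul0r.
apply: (@eq_integrable _ _ _ mu D mD
  (fun x => (q.[x] * weight (s + 1) t x)%:E + (c%:E * (weight s t x)%:E))%E).
  move=> x; rewrite inE /= in_itv /= andbT => x0.
  rewrite -mul_weight// hornerMXaddC -EFinM -EFinD; congr EFin; ring.
apply: integrableD => //; first exact: IH.
apply: integrableZl => //; exact: (integrable_weight _ _ t0).
Qed.

Lemma wint_linear s t : 0 < t -> linear (wint s t).
Proof.
move=> t0 c q1 q2; have mD : measurable D by exact: measurable_itv.
have I1 := integrable_poly_weight s t q1 t0.
have I2 := integrable_poly_weight s t q2 t0.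
rewrite /wint /GRing.scale /= -RintegralZl// -RintegralD//.
  by apply: eq_Rintegral => x _; rewrite hornerD hornerZ; ring.
rewrite (_ : _ \o _ =
  (fun x => c%:E * (EFin \o (fun x => (q1.[x] * weight s t x)%R)) x)%E)//.
exact: integrableZl.
Qed.

Definition wint_form s {t} (t0 : 0 < t) : {linear {poly R} -> R^o} :=
  HB.pack_for {linear {poly R} -> R^o} (wint s t)
  (GRing.isLinear.Build R {poly R} R^o *:%R (wint s t) (wint_linear s t t0)).

Lemma wint_mulX s t q : wint s t ('X * q) = wint (s + 1) t q.
Proof.
apply: eq_Rintegral => x; rewrite inE /= in_itv /= andbT => x0.
by rewrite hornerM hornerX -mul_weight//; ring.
Qed.

Lemma wint_sqr_ge0 s t q : 0 <= wint s t (q ^+ 2).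
Proof.
apply: Rintegral_ge0 => x _; rewrite mulr_ge0 ?weight_ge0//.
by rewrite horner_exp sqr_ge0.
Qed.

Lemma wintC s t c : 0 < t -> wint s t c%:P = c * moment s t.
Proof.
move=> t0; rewrite /moment -RintegralZl//; last exact: (integrable_weight _ _ t0).
by apply: eq_Rintegral => x _; rewrite hornerC.
Qed.

(** This is the integral of the derivative of [q * x^2 * weight s t].  By
    linearity and [wint_mulX] it reduces to [q] constant, that is, to
    [moment_rec]. *)
Lemma wint_pearson s t q : 0 < t ->
  wint s t ('X^2 * q^`()) + (s + 2) * wint s t ('X * q)
    - wint s t ('X^2 * q) + t * wint s t q = 0.
Proof.
move=> t0.
have LD s' p1 p2 : wint s' t (p1 + p2) = wint s' t p1 + wint s' t p2.
  exact: (linearD (wint_form s' t0)).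
have L0 s' : wint s' t 0 = 0 by exact: (linear0 (wint_form s' t0)).
elim/poly_ind: q s => [|q c IH] s.
  by rewrite deriv0 !mulr0 !L0; ring.
have := moment_rec (s + 2) t t0; rewrite addrK.
have -> : s + 2 - 1 = s + 1 by ring.
move=> Hc; have {IH} := IH (s + 1).
have -> : 'X^2 * (q * 'X + c%:P)^`() = 'X * ('X^2 * q^`()) + 'X * ('X * q).
  by rewrite derivD derivC addr0 derivM derivX; ring.
have -> : 'X * (q * 'X + c%:P) = 'X * ('X * q) + 'X * c%:P by ring.
have -> : 'X^2 * (q * 'X + c%:P) = 'X * ('X^2 * q) + 'X * ('X * c%:P) by ring.
have -> : q * 'X + c%:P = 'X * q + c%:P by ring.
rewrite !LD [wint s t ('X * ('X * c%:P))]wint_mulX.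
rewrite ![wint s t ('X * _)]wint_mulX.
rewrite ![wint (s + 1) t ('X * c%:P)]wint_mulX !wintC//.
have -> : s + 1 + 1 = s + 2 by ring.
move: Hc => /(congr1 (fun y => c * y)); lra.
Qed.

End Moments.

(** * Discrete equations from the Pearson identity *)

(** This is [t] times the integral of [P_n^2 w / x], see [rcoef_Lam]; unlike the
    formula, that integral shows that [r_n] does not vanish. *)
Definition rcoef {R : realType} (nu : R) P n (t : R) : R :=
  Bcoef P n t - nu - 1 - 2 * n%:R.

(** This is [t A_n] times the integral of [P_n P_(n-1) w / x], see [Zcoef_Lam]. *)
Definition Zcoef {R : realType} P n (t : R) : R :=
  Acoef P n t ^+ 2 + bcoef P n t / acoef P n t.

(** In this section [t] is fixed.  The form [Lam] stands for integration
    against [w / x], so that orthonormality with respect to [w] is stated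
    with an additional factor ['X], and the constant terms of the polynomials
    enter through [Lam] itself. *)
Section Algebra.
Context {R : realType}.
Variables (Lam : {linear {poly R} -> R^o}) (nu t : R).
Hypothesis t_gt0 : 0 < t.
Hypothesis pearson : forall q : {poly R},
  Lam ('X^2 * q^`()) + (nu + 1) * Lam ('X * q) - Lam ('X^2 * q) + t * Lam q = 0.
Hypothesis Lam_sqr_ge0 : forall q : {poly R}, 0 <= Lam (q ^+ 2).
Variable P : nat -> R -> {poly R}.
Local Notation p n := (P n t).
Local Notation a n := (acoef P n t).
Local Notation b n := (bcoef P n t).
Local Notation A n := (Acoef P n t).
Local Notation B n := (Bcoef P n t).
Local Notation r n := (rcoef nu P n t).
Local Notation Z n := (Zcoef P n t).
Hypothesis szp : forall n, size (p n) = n.+1.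
Hypothesis orthp : forall n m, Lam ('X * (p n * p m)) = (n == m)%:R.

Lemma acoef_neq0 n : a n != 0.
Proof.
have := lead_coefE (p n); rewrite szp /= => an.
by rewrite /acoef -an lead_coef_eq0 -size_poly_eq0 szp.
Qed.

Lemma size_cancel_lead k (q : {poly R}) : (size q <= k.+1)%N ->
  (size (q - (q`_k / a k) *: p k)%R <= k)%N.
Proof.
move=> sq; apply/leq_sizeP => j; rewrite leq_eqVlt => /predU1P[<-|kj].
  by rewrite coefB coefZ mulfVK ?subrr// acoef_neq0.
by rewrite coefB coefZ (nth_default _ (leq_trans sq kj)) [(p k)`_j]nth_default
  ?mulr0 ?subr0 ?szp.
Qed.

Lemma orthogonal_lower_degree n (q : {poly R}) : (size q <= n)%N ->
  Lam ('X * (q * p n)) = 0.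
Proof.
have H : forall k (q : {poly R}), (size q <= k)%N -> (k <= n)%N ->
    Lam ('X * (q * p n)) = 0.
  elim=> [|k IH] {}q sq kn.
    by move: sq; rewrite leqn0 size_poly_eq0 => /eqP ->; rewrite mul0r mulr0 linear0.
  pose c := q`_k / a k.
  have -> : q = (q - c *: p k) + c *: p k by rewrite subrK.
  rewrite mulrDl mulrDr linearD /= IH ?(ltnW kn) ?size_cancel_lead// add0r.
  by rewrite -scalerAl -scalerAr linearZ /= orthp (ltn_eqF kn) scaler0.
by move=> sq; apply: (H n).
Qed.

Lemma pairing_same_degree n (q : {poly R}) : (size q <= n.+1)%N ->
  Lam ('X * (q * p n)) = q`_n / a n.
Proof.
move=> sq; pose c := q`_n / a n.
rewrite {1}(_ : q = (q - c *: p n) + c *: p n); last by rewrite subrK.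
rewrite mulrDl mulrDr linearD /= orthogonal_lower_degree ?size_cancel_lead//.
rewrite -scalerAl -scalerAr linearZ /= orthp eqxx add0r.
by rewrite /GRing.scale /= mulr1.
Qed.

(** Cancelling the term of degree [n + 1] by a multiple of [p n.+1] changes the
    coefficient of degree [n] and reduces to [pairing_same_degree]. *)
Lemma pairing_next_degree n (q : {poly R}) : (size q <= n.+2)%N ->
  Lam ('X * (q * p n)) = (q`_n - q`_n.+1 * (b n.+1 / a n.+1)) / a n.
Proof.
move=> sq; pose c := q`_n.+1 / a n.+1.
rewrite {1}(_ : q = (q - c *: p n.+1) + c *: p n.+1); last by rewrite subrK.
rewrite mulrDl mulrDr linearD /= pairing_same_degree ?size_cancel_lead//.
rewrite (_ : 'X * (c *: p n.+1 * p n) = c *: ('X * (p n.+1 * p n))); last first.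
  by rewrite -!mul_polyC; ring.
rewrite coefB coefZ [Lam (c *: _)]linearZ /= orthp eqn_leq ltnn /= scaler0 addr0.
by rewrite /c /bcoef; congr (_ / _); rewrite -mulrA [_^-1 * _]mulrC mulrA.
Qed.

Lemma coef_Xdp n j : ('X * (p n)^`())`_j = j%:R * (p n)`_j.
Proof.
rewrite coefXM; case: j => [|j] /=; first by rewrite mul0r.
by rewrite coef_deriv mulr_natl.
Qed.

Lemma size_Xdp n : (size ('X * (p n)^`())%R <= n.+1)%N.
Proof.
apply/leq_sizeP => j nj; rewrite coef_Xdp nth_default ?mulr0// szp //.
Qed.

Lemma size_Xp n : (size ('X * p n)%R <= n.+2)%N.
Proof. by rewrite mulrC size_mulX ?szp// -size_poly_eq0 szp. Qed.

Lemma Lam_X2_diag n : Lam ('X^2 * (p n * p n)) = B n.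
Proof.
have -> : 'X^2 * (p n * p n) = 'X * ('X * p n * p n) by ring.
rewrite pairing_next_degree ?size_Xp// !coefXM /= -/(a n).
have -> : (if n == 0 then 0 else (p n)`_n.-1) = b n by case: n.
by rewrite mulrBl [a n * _]mulrC mulfK// acoef_neq0.
Qed.

Lemma Lam_X2_offdiag n : Lam ('X^2 * (p n.+1 * p n)) = A n.+1.
Proof.
have -> : 'X^2 * (p n.+1 * p n) = 'X * ('X * p n * p n.+1) by ring.
by rewrite pairing_same_degree ?size_Xp// !coefXM.
Qed.

(** The Pearson identity for [q = p n * p n]; [x p_n'] has leading coefficient
    [n a_n], so its pairing with [p_n] is [n]. *)
Lemma rcoef_Lam n : r n = t * Lam (p n * p n).
Proof.
have := pearson (p n * p n).
have -> : 'X^2 * (p n * p n)^`() = 'X * ('X * (p n)^`() * p n) *+ 2.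
  by rewrite derivM; ring.
rewrite raddfMn /= pairing_same_degree ?size_Xdp// coef_Xdp -/(a n) mulfK ?acoef_neq0//.
rewrite orthp eqxx Lam_X2_diag /rcoef mulr1 => H; rewrite -mulr_natr in H; lra.
Qed.

(** The Pearson identity for [q = p n.+1 * p n].  Of the two terms of the
    product rule, the one with [x p_n'] vanishes because its degree is only
    [n]; the other is evaluated by [pairing_next_degree]. *)
Lemma Zcoef_Lam n : Z n.+1 = t * A n.+1 * Lam (p n.+1 * p n).
Proof.
have := pearson (p n.+1 * p n).
have -> : 'X^2 * (p n.+1 * p n)^`() =
    'X * ('X * (p n.+1)^`() * p n) + 'X * ('X * (p n)^`() * p n.+1).
  by rewrite derivM; ring.
rewrite linearD /= pairing_next_degree ?size_Xdp// orthogonal_lower_degree ?size_Xdp//.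
rewrite !coef_Xdp -/(a n) -/(a n.+1) -[(p n.+1)`_n]/(b n.+1).
rewrite orthp eqn_leq ltnn /= Lam_X2_offdiag /Zcoef /= => H.
have -> : t * (a n / a n.+1) * Lam (p n.+1 * p n) =
    a n / a n.+1 * (t * Lam (p n.+1 * p n)) by ring.
have -> : t * Lam (p n.+1 * p n) = a n / a n.+1 -
   ((n%:R * b n.+1 - n.+1%:R * a n.+1 * (b n.+1 / a n.+1)) / a n).
  by move: H; set u := _ / a n; rewrite /Acoef; lra.
have := acoef_neq0 n; have := acoef_neq0 n.+1; rewrite -natr1 -[(p n.+1)`_n]/(b n.+1).
by move: (a n) (a n.+1) (b n.+1) => x y z y0 x0; field; rewrite x0 y0.
Qed.

Lemma poly_split_constant (q : {poly R}) :
  {q' : {poly R} | q = q' * 'X + (q`_0)%:P & (size q' <= (size q).-1)%N}.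
Proof.
exists (\poly_(i < (size q).-1) q`_i.+1).
  apply/polyP => -[|i]; rewrite coefD coefMX coefC /= ?add0r// addr0 coef_poly.
  case: ltnP => // sq; rewrite nth_default//; move: sq; by case: (size q).
exact: size_poly.
Qed.

(** In the next three lemmas one factor is replaced by its constant term plus
    a multiple of ['X]; the pairing of the latter is known from
    orthonormality. *)
Lemma Lam_diag_split n : Lam (p n * p n) = (p n)`_0 * Lam (p n).
Proof.
have [q Hq sq] := poly_split_constant (p n); rewrite szp /= in sq.
rewrite {1}Hq mulrDl linearD /= -[q * _ * _]mulrA [q * _]mulrC.
have -> : 'X * p n * q = 'X * (q * p n) by ring.
by rewrite orthogonal_lower_degree // add0r mul_polyC linearZ.
Qed.

Lemma Lam_offdiag_split_low n :
  Lam (p n.+1 * p n) = (p n)`_0 * Lam (p n.+1).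
Proof.
have [q Hq sq] := poly_split_constant (p n); rewrite szp /= in sq.
rewrite {1}Hq mulrDr linearD /=.
have -> : p n.+1 * (q * 'X) = 'X * (q * p n.+1) by ring.
by rewrite orthogonal_lower_degree ?(leq_trans sq)// add0r mulrC mul_polyC linearZ.
Qed.

(** Splitting the factor of higher degree instead leaves a quotient of degree
    [n], whose pairing with [p n] is a ratio of leading coefficients. *)
Lemma Lam_offdiag_split_high n :
  Lam (p n.+1 * p n) = (p n.+1)`_0 * Lam (p n) + (A n.+1)^-1.
Proof.
have [q Hq sq] := poly_split_constant (p n.+1); rewrite szp /= in sq.
rewrite {1}Hq mulrDl linearD /=.
have -> : q * 'X * p n = 'X * (q * p n) by ring.
rewrite pairing_same_degree // mul_polyC linearZ /= addrC; congr (_ + _).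
rewrite /Acoef invf_div /acoef [p n.+1 in RHS]Hq coefD coefMX coefC /= addr0 //.
Qed.

(** With [f_n] the constant term of [p_n] and [e_n = Lam (p_n)], the lemmas
    above read [r_n = t f_n e_n], [Z_(n+1) = t A_(n+1) f_n e_(n+1)] and
    [Z_(n+1) - t = t A_(n+1) f_(n+1) e_n]; both sides of the equation are
    [t^2 A_(n+1)^2 f_n f_(n+1) e_n e_(n+1)]. *)
Lemma discrete_second n :
  A n.+1 ^+ 2 * r n.+1 * r n = Z n.+1 ^+ 2 - t * Z n.+1.
Proof.
have A0 : A n.+1 != 0 by rewrite mulf_neq0 ?invr_eq0 ?acoef_neq0.
have H1 := Zcoef_Lam n; have H2 := Zcoef_Lam n.
rewrite Lam_offdiag_split_low in H1; rewrite Lam_offdiag_split_high mulrDr mulfK // in H2.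
have -> : Z n.+1 ^+ 2 - t * Z n.+1 = Z n.+1 * (Z n.+1 - t) by ring.
rewrite {2}H2 H1 addrK !rcoef_Lam !Lam_diag_split; ring.
Qed.

Lemma pairing_nondegenerate n (q : {poly R}) : (size q <= n)%N ->
  (forall m, (m < n)%N -> Lam ('X * (q * p m)) = 0) -> q = 0.
Proof.
elim: n => [|n IH] sq H.
  by apply/eqP; rewrite -size_poly_eq0 -leqn0.
apply: IH => [|m mn]; last by apply: H; rewrite ltnS ltnW.
have /eqP := H n (leqnn _); rewrite pairing_same_degree// mulf_eq0 invr_eq0.
rewrite (negPf (acoef_neq0 n)) orbF => /eqP qn.
apply/leq_sizeP => j; rewrite leq_eqVlt => /predU1P[<-//|kj].
by rewrite nth_default// (leq_trans sq).
Qed.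

(** By [pairing_nondegenerate] it suffices to pair both sides with [p m] for [m <= n + 1],
    where the polynomial of degree [n + 2] does not occur. *)
Lemma three_term_recurrence n : 'X * p n = A n.+1 *: p n.+1 + B n *: p n +
    A n *: (if n is m.+1 then p m else 0).
Proof.
apply/eqP; rewrite -subr_eq0; apply/eqP; apply: (@pairing_nondegenerate n.+2).
  apply/leq_sizeP => j nj; rewrite !(coefB, coefD, coefZ) coefXM.
  case: j nj => // j nj; rewrite /= !(@nth_default _ _ (p _)) ?szp// ?(ltnW nj)//.
  case: n nj => [|n] nj; first by rewrite coef0 !mulr0 !addr0 subrr.
  by rewrite nth_default ?szp ?(ltnW (ltnW nj))// !mulr0 !addr0 subrr.
move=> m; rewrite ltnS => mn.
rewrite mulrBl mulrBr linearB /= !mulrDl !mulrDr !linearD /=.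
rewrite -!scalerAl -!scalerAr !linearZ /= !orthp.
have -> : 'X * ('X * p n * p m) = 'X * ('X * p m * p n) by ring.
rewrite /GRing.scale /= -/(A n.+1) !mulrN.
have [->|mn1] := eqVneq m n.+1.
  have -> : 'X * ('X * p n.+1 * p n) = 'X^2 * (p n.+1 * p n) by ring.
  rewrite Lam_X2_offdiag (ltn_eqF (ltnSn n)) mulr1 mulr0 subr0 addrA subrr sub0r.
  case: n mn => [|n] mn; first by rewrite mul0r oppr0.
  by rewrite orthp ltn_eqF// mulr0 oppr0.
have {mn1} mn : (m <= n)%N by rewrite -ltnS ltn_neqAle mn1 mn.
rewrite mulr0 oppr0 sub0r.
move: mn; rewrite leq_eqVlt => /predU1P[->|mn].
  have -> : 'X * ('X * p n * p n) = 'X^2 * (p n * p n) by ring.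
  rewrite Lam_X2_diag eqxx mulr1 addrA subrr sub0r.
  case: n => [|n]; first by rewrite mul0r oppr0.
  by rewrite orthp ltn_eqF// mulr0 oppr0.
rewrite (gtn_eqF mn) mulr0 oppr0 sub0r.
case: n mn => // n; rewrite ltnS leq_eqVlt orthp => /predU1P[->|mn].
  have -> : 'X * ('X * p n * p n.+1) = 'X^2 * (p n.+1 * p n) by ring.
  by rewrite Lam_X2_offdiag eqxx mulr1 subrr.
rewrite (gtn_eqF mn) mulr0 subr0 orthogonal_lower_degree// (leq_trans (size_Xp m))//.
Qed.

(** The three-term recurrence is multiplied by [p n], and [t * Lam] is applied:
    the left-hand side gives [t] by normalisation, and the right-hand side
    consists of the integrals computed in [rcoef_Lam] and [Zcoef_Lam]. *)
Lemma discrete_first n : Z n.+1 + Z n = t - B n * r n.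
Proof.
have := congr1 (fun q => t * Lam (q * p n)) (three_term_recurrence n).
have -> : 'X * p n * p n = 'X * (p n * p n) by ring.
rewrite orthp eqxx !(mulrDl _ _ (p n)) !linearD /= -!scalerAl !linearZ /= /GRing.scale /=.
have HZ : Z n = t * (A n * Lam ((if n is m.+1 then p m else 0) * p n)).
  case: n => [|n]; first by rewrite [LHS](_ : _ = 0 ^+ 2 + 0 / a 0)//
    expr0n /= !mul0r mulr0 addr0.
  by rewrite Zcoef_Lam [p n * _]mulrC [RHS]mulrA.
rewrite -/(A n.+1) Zcoef_Lam rcoef_Lam HZ mulr1; lra.
Qed.

(** If the integral of [p_n^2 w / x] were zero, that of [(1 - c x)^2 p_n^2 w / x]
    would be [- 2 c + c^2 B_n], which is negative for small [c > 0]. *)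
Lemma rcoef_neq0 n : r n != 0.
Proof.
apply/negP => /eqP r0.
have H c : 0 <= - 2 * c + c ^+ 2 * B n.
  have := Lam_sqr_ge0 ((1 - c *: 'X) * p n).
  have -> : ((1 - c *: 'X) * p n) ^+ 2 = p n * p n
      + (- 2 * c) *: ('X * (p n * p n)) + c ^+ 2 *: ('X^2 * (p n * p n)).
    rewrite -!mul_polyC !polyCM; ring.
  rewrite !linearD !linearZ /= orthp eqxx Lam_X2_diag /GRing.scale /=.
  have -> : Lam (p n * p n) = 0.
    by have /eqP := rcoef_Lam n; rewrite r0 eq_sym mulf_eq0 (gt_eqF t_gt0) => /eqP.
  by rewrite mulr1 add0r.
(* a positive [c] with [c * B n <= 1 < 2] *)
have := H (`|B n| + 1)^-1.
have B0 : 0 < `|B n| + 1 by rewrite ltr_wpDl.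
set c := _^-1; have c0 : 0 < c by rewrite invr_gt0.
have -> : -2 * c + c ^+ 2 * B n = c * (c * B n - 2) by ring.
rewrite pmulr_rge0// subr_ge0 => H2.
have : c * B n <= 1.
  rewrite /c mulrC ler_pdivrMr// mul1r (le_trans (ler_norm _))// lerDl //.
lra.
Qed.
End Algebra.

(** * Propagation of the Toda equations *)

Lemma is_derive_eq_pos {R : realType} (f g : R -> R) (t d : R) : 0 < t ->
  (forall s : R, 0 < s -> f s = g s) -> is_derive t 1 f d -> is_derive t 1 g d.
Proof.
move=> t0 fg; apply: near_eq_is_derive; near=> s; apply: fg.
by near: s; exact: lt_nbhsr.
Unshelve. all: by end_near. Qed.

(** The two identities below are the algebra of the induction step in [toda_equations].
    The indices [0], [1], [2] stand for [n], [n + 1], [n + 2], and [r'] is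
    [r_(n-1)].  In each proof the difference of the two sides is displayed as
    a combination of the hypotheses, after multiplication by [r] in the first
    one. *)
Lemma toda_alpha_identity {R : fieldType} (t be r r' r1 al0 al1 Z0 Z1 : R) :
  r != 0 -> al0 * r * r' = Z0 ^+ 2 - t * Z0 -> al1 * r1 * r = Z1 ^+ 2 - t * Z1 ->
  Z1 + Z0 = t - be * r -> al1 - al0 = Z1 - Z0 + be ->
  t - (Z0 - Z1) * (be + r) - al0 * (r' - r) - Z0 - Z1 = al1 * (r - r1).
Proof.
move=> rn0 H0 H1 H HZ; apply: (mulfI rn0); apply/eqP; rewrite -subr_eq0; apply/eqP.
have -> : al1 = al0 + (Z1 - Z0 + be) by rewrite -HZ; ring.
have {}H1 : (al0 + (Z1 - Z0 + be)) * r1 * r = Z1 ^+ 2 - t * Z1.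
  by rewrite -H1 -HZ; ring.
transitivity ((al0 + (Z1 - Z0 + be)) * r1 * r - (Z1 ^+ 2 - t * Z1)
  - (al0 * r * r' - (Z0 ^+ 2 - t * Z0))
  + (r + (Z0 - Z1)) * (t - be * r - (Z1 + Z0))); first by ring.
by rewrite H0 H1 H !subrr; ring.
Qed.

Lemma toda_beta_identity {R : fieldType} (t be r be1 r1 al1 Z0 Z1 Z2 : R) :
  al1 * r1 * r = Z1 ^+ 2 - t * Z1 -> Z1 + Z0 = t - be * r ->
  Z2 + Z1 = t - be1 * r1 -> be1 - r1 = be - r + 2 ->
  (2 * Z1 - t) * (al1 * (r - r1) + Z1) - t * Z1
    - r1 * (al1 * (r - r1) * r + al1 * (Z0 - Z1)) = al1 * r * (Z1 - Z2).
Proof.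
move=> H1 H H2 Hb.
apply/eqP; rewrite -subr_eq0; apply/eqP.
transitivity (2 * (Z1 ^+ 2 - t * Z1 - al1 * r1 * r)
  + al1 * r * (Z2 + Z1 - (t - be1 * r1)) + al1 * r1 * (t - be * r - (Z1 + Z0))
  + al1 * r * r1 * (be - r + 2 - (be1 - r1))); first by ring.
by rewrite H1 H H2 Hb !subrr !mulr0 !addr0.
Qed.

(** Here [al], [be] and [q] play the roles of [A_n^2], [B_n] and [b_n / a_n]. *)
Section Propagation.
Context {R : realType}.
Variables (nu : R) (al be q : nat -> R -> R).
Local Notation r n s := (be n s - nu - 1 - 2 * n%:R).
Local Notation Z n s := (al n s + q n s).
Hypothesis al0 : forall s, al 0 s = 0.
Hypothesis q0 : forall s, q 0 s = 0.
Hypothesis beE : forall n (s : R), be n s = q n s - q n.+1 s.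
Hypothesis first_eq : forall n (s : R), 0 < s -> Z n.+1 s + Z n s = s - be n s * r n s.
Hypothesis second_eq : forall n (s : R), 0 < s ->
  al n.+1 s * r n.+1 s * r n s = Z n.+1 s ^+ 2 - s * Z n.+1 s.
Hypothesis al_neq0 : forall n (s : R), 0 < s -> al n.+1 s != 0.
Hypothesis r_neq0 : forall n (s : R), 0 < s -> r n s != 0.
Hypothesis riccati : forall s : R, 0 < s ->
  is_derive s 1 (be 0) ((be 0 s ^+ 2 - (nu + 1) * be 0 s - s) / s).

(** For [r_n] and [al_(n+1)] different from zero, the first equation determines
    [al_(n+1)] and the second one [be_(n+1)] as rational functions of the
    quantities of index [n]; so differentiability passes from [n] to [n + 1],
    and the derivatives are obtained by differentiating the two equations.
    The three formulas are proved together because each is used for the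
    next index.  For [n = 0] the second formula holds for any value in place
    of [r_(-1)], as [al_0] is zero. *)
Lemma toda_equations n (t : R) : 0 < t ->
  [/\ is_derive t 1 (q n) (Z n t / t),
      is_derive t 1 (al n) (al n t * (r n.-1 t - r n t) / t) &
      is_derive t 1 (be n) ((Z n t - Z n.+1 t) / t)].
Proof.
move=> t0; have tn0 : t != 0 by rewrite gt_eqF.
elim: n => [|n [dq dal dbe]].
  have z0 : Z 0 t = 0 by rewrite al0 q0 addr0.
  split.
  - rewrite z0 mul0r (_ : q 0 = cst 0); first exact: is_derive_cst.
    by apply/funext => s; rewrite q0.
  - rewrite al0 !mul0r (_ : al 0 = cst 0); first exact: is_derive_cst.
    by apply/funext => s; rewrite al0.
  - have HR := riccati t t0; apply: is_derive_eq; congr (_ / _).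
    have := first_eq 0 t t0; rewrite z0; lra.
have H1 := first_eq n t t0; have H2 := second_eq n t t0.
have H1' := first_eq n.+1 t t0.
have rn0 := r_neq0 n t t0; have aln0 := al_neq0 n t t0.
have H2' : al n t * r n t * r n.-1 t = Z n t ^+ 2 - t * Z n t.
  by case: (n) => [|m]; [rewrite al0 q0; ring | exact: second_eq].
have Hb := beE n t.
have dq1 : is_derive t 1 (q n.+1) (Z n.+1 t / t).
  apply: (@is_derive_eq_pos _ (fun s => q n s - be n s)) => //.
    by move=> s _; rewrite beE opprB addrC subrK.
  by apply: is_derive_eq; field.
have dal1 : is_derive t 1 (al n.+1) (al n.+1 t * (r n t - r n.+1 t) / t).
  apply: (@is_derive_eq_pos _ (fun s => s - be n s * r n s - Z n s - q n.+1 s)) => //.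
    by move=> s s0; rewrite -first_eq//; ring.
  apply: is_derive_eq; rewrite /GRing.scale /=.
  apply: (mulfI tn0).
  transitivity (t - (Z n t - Z n.+1 t) * (be n t + r n t)
      - al n t * (r n.-1 t - r n t) - Z n t - Z n.+1 t); first by field.
  rewrite (toda_alpha_identity _ _ _ _ _ _ _ _ _ rn0 H2' H2 H1); first by field.
  by rewrite Hb; ring.
split; [exact: dq1|exact: dal1|].
(* [be_(n+1)] is obtained from the second equation as [c + N / M]. *)
pose N s := Z n.+1 s ^+ 2 - s * Z n.+1 s.
pose M s := al n.+1 s * r n s.
pose c : R := nu + 1 + 2 * n.+1%:R.
have M0 : M t != 0 by rewrite mulf_neq0.
have dN : is_derive t 1 N
    (((2 * Z n.+1 t - t) * (al n.+1 t * (r n t - r n.+1 t) + Z n.+1 t)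
      - t * Z n.+1 t) / t).
  by apply: is_derive_eq; rewrite /GRing.scale /=; field.
have dM : is_derive t 1 M
    ((al n.+1 t * (r n t - r n.+1 t) * r n t + al n.+1 t * (Z n t - Z n.+1 t)) / t).
  by apply: is_derive_eq; rewrite /GRing.scale /=; field.
have dV : is_derive t 1 (fun s => (M s)^-1) _ := is_deriveV M0 dM.
apply: (is_derive_eq_pos (fun s => c + N s * (M s)^-1) _ _ _ t0).
  move=> s s0; rewrite /N -second_eq//.
  have Ms0 : M s != 0 by rewrite mulf_neq0 ?al_neq0 ?r_neq0.
  have -> : al n.+1 s * r n.+1 s * r n s = r n.+1 s * M s by rewrite /M; ring.
  by rewrite mulfK// /c; ring.
apply: is_derive_eq; rewrite /GRing.scale /=.
have Hr : be n.+1 t - r n.+1 t = be n t - r n t + 2 by rewrite -natr1; ring.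
have /(canRL (subrK _)) -> := toda_beta_identity _ _ _ _ _ _ _ _ _ H2 H1 H1' Hr.
have -> : N t = r n.+1 t * M t by rewrite /N -H2 /M; ring.
rewrite (_ : al n.+1 t * r n t = M t)//; move: (M t) M0 => m m0.
by field; rewrite tn0 m0.
Qed.

End Propagation.

(** * The orthonormal family *)

Section OrthonormalFamily.
Context {R : realType}.
Variables (nu : R) (P : nat -> R -> {poly R}).
Hypothesis hP : orthonormal_family nu P.

Lemma family_size t n : 0 < t -> size (P n t) = n.+1.
Proof. by move=> t0; have [/(_ n)[]] := hP t t0. Qed.

Lemma family_orth t n m : 0 < t ->
  wint (nu - 1) t ('X * (P n t * P m t)) = (n == m)%:R.
Proof.
move=> t0; have [_ /(_ n m) H] := hP t t0.
rewrite wint_mulX subrK /wint /Rintegral.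
under eq_integral do rewrite hornerM.
by rewrite H.
Qed.

Lemma family_pearson (t : R) (t0 : 0 < t) q :
  wint_form (nu - 1) t0 ('X^2 * q^`())
   + (nu + 1) * wint_form (nu - 1) t0 ('X * q)
   - wint_form (nu - 1) t0 ('X^2 * q) + t * wint_form (nu - 1) t0 q = 0.
Proof.
have := wint_pearson (nu - 1) t q t0.
by rewrite (_ : nu - 1 + 2 = nu + 1); last by ring.
Qed.

Lemma family_A_neq0 (t : R) n : 0 < t -> Acoef P n.+1 t ^+ 2 != 0.
Proof.
move=> t0; rewrite expf_neq0// mulf_neq0 ?invr_eq0//.
  by apply: acoef_neq0 => m; exact: family_size.
by apply: acoef_neq0 => m; exact: family_size.
Qed.

Lemma family_first (t : R) n : 0 < t ->
  Zcoef P n.+1 t + Zcoef P n t = t - Bcoef P n t * rcoef nu P n t.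
Proof.
move=> t0; apply: (discrete_first (wint_form (nu - 1) t0)) => [q|m|m k].
- exact: family_pearson.
- exact: family_size.
- exact: family_orth.
Qed.

Lemma family_second (t : R) n : 0 < t ->
  Acoef P n.+1 t ^+ 2 * rcoef nu P n.+1 t * rcoef nu P n t =
  Zcoef P n.+1 t ^+ 2 - t * Zcoef P n.+1 t.
Proof.
move=> t0; apply: (discrete_second (wint_form (nu - 1) t0)) => [q|m|m k].
- exact: family_pearson.
- exact: family_size.
- exact: family_orth.
Qed.

Lemma family_r_neq0 (t : R) n : 0 < t -> rcoef nu P n t != 0.
Proof.
move=> t0; apply: (rcoef_neq0 (wint_form (nu - 1) t0)) => [//|q|q|m|m k].
- exact: family_pearson.
- exact: wint_sqr_ge0.
- exact: family_size.
- exact: family_orth.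
Qed.

Lemma B0_moment (t : R) : 0 < t ->
  moment nu t != 0 /\ Bcoef P 0 t = moment (nu + 1) t / moment nu t.
Proof.
move=> t0.
have HB := Lam_X2_diag (wint_form (nu - 1) t0) t P
  (fun n => family_size t n t0) (fun n m => family_orth t n m t0) 0.
have H1 := family_orth t 0 0 t0.
have [c Hc] : exists c, P 0 t * P 0 t = c%:P.
  have /eqP := family_size t 0 t0; rewrite eqn_leq => /andP[/size1_polyC -> _].
  by exists ((P 0 t)`_0 * (P 0 t)`_0); rewrite polyCM.
have {}HB : wint (nu - 1) t ('X^2 * (P 0 t * P 0 t)) = Bcoef P 0 t by exact: HB.
move: H1 HB; rewrite Hc expr2 -mulrA !wint_mulX !wintC// subrK eqxx => H1 <-.
have m0 : moment nu t != 0.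
  by apply/eqP => m0; move/eqP: H1; rewrite m0 mulr0 eq_sym oner_eq0.
by split=> //; apply: (canRL (mulfK m0)); rewrite mulrAC H1 mul1r.
Qed.

(** [B_0] is the quotient of two consecutive moments, whose derivatives are
    minus the preceding moments; [moment_rec] expresses the moment of exponent
    [nu - 1] in its derivative through the two of the quotient. *)
Lemma riccati_B0 (t : R) : 0 < t ->
  is_derive t 1 (Bcoef P 0) ((Bcoef P 0 t ^+ 2 - (nu + 1) * Bcoef P 0 t - t) / t).
Proof.
move=> t0; have [m0 Bt] := B0_moment t t0.
have d0 := is_derive_moment nu t t0.
have d1 := is_derive_moment (nu + 1) t t0; rewrite addrK in d1.
have dV : is_derive t 1 (fun s => (moment nu s)^-1) _ := is_deriveV m0 d0.
apply: (is_derive_eq_pos (fun s => moment (nu + 1) s * (moment nu s)^-1) _ _ _ t0).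
  by move=> s /B0_moment[].
apply: is_derive_eq; rewrite /GRing.scale /= Bt.
have := moment_rec (nu + 1) t t0; rewrite addrK.
have -> : nu + 1 - 2 = nu - 1 by ring.
move=> H.
have -> : moment (nu - 1) t = (moment (nu + 1) t - (nu + 1) * moment nu t) / t.
  apply: (canRL (mulfK _)); first by rewrite gt_eqF.
  by move: H; lra.
by field; rewrite m0 gt_eqF.
Qed.

Lemma family_toda (t : R) n : 0 < t ->
  is_derive t 1 (Bcoef P n) ((Zcoef P n t - Zcoef P n.+1 t) / t).
Proof.
move=> t0.
have [] := @toda_equations R nu (fun n s => Acoef P n s ^+ 2) (Bcoef P)
  (fun n s => bcoef P n s / acoef P n s) _ _ _ _ _ _ _ _ n t t0 => //.
- by move=> s; rewrite expr0n.
- by move=> s; rewrite mul0r.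
- by move=> m s; exact: family_first.
- by move=> m s; exact: family_second.
- by move=> m s; exact: family_A_neq0.
- by move=> m s; exact: family_r_neq0.
- exact: riccati_B0.
Qed.

End OrthonormalFamily.

Theorem theorem4 (R : realType) (nu : R) (P : nat -> R -> {poly R})
    (hP : orthonormal_family nu P) (t : R) (ht : 0 < t) :
  let a := acoef P in
  let b := bcoef P in
  let A := Acoef P in
  let B := Bcoef P in
  (forall n : nat,
     A n.+1 t ^+ 2 + B n t ^+ 2 + A n t ^+ 2
       - (2 * n%:R + nu + 2) * B n t + 2 * (b n t / a n t) - t = 0)
  /\
  (forall n : nat, (1 <= n)%N ->
     A n t ^+ 2 * (B n t - nu - 1 - 2 * n%:R)
                * (B n.-1 t - nu + 1 - 2 * n%:R)
       - (A n t ^+ 2 + b n t / a n t) ^+ 2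
       + t * (A n t ^+ 2 + b n t / a n t) = 0)
  /\
  (forall n : nat, (1 <= n)%N ->
     derivable (fun s : R => B n.-1 s + B n s) t 1 /\
     t * derive1 (fun s : R => B n.-1 s + B n s) t
       + (B n.-1 t + B n t) * (B n.-1 t - B n t + 1)
       - (2 * n%:R + nu) * (B n.-1 t - B n t) = 0).
Proof.
move=> a b A B; split; [|split].
(* [b_(n+1) / a_(n+1)] equals [b_n / a_n - B_n] by definition of [B_n]. *)
- move=> n; have := family_first _ _ hP t n ht.
  have -> : Zcoef P n.+1 t = A n.+1 t ^+ 2 + (b n t / a n t - B n t).
    by rewrite /Zcoef; congr (_ + _); rewrite /B /Bcoef opprB addrC subrK.
  by rewrite /Zcoef /rcoef -/(A n t) -/(B n t) -/(a n t) -/(b n t); lra.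
- case=> // n _; have := family_second _ _ hP t n ht.
  rewrite /Zcoef /rcoef -/(A n.+1 t) -/(B n.+1 t) -/(B n t) -/(a n.+1 t) -/(b n.+1 t) /=
    -natr1.
  by lra.
(* Two instances of the first equation express [Z_n] and [Z_(n+2)] through
   [Z_(n+1)], which then cancels in the sum of the two Toda equations. *)
case=> // n _ /=.
have dn := family_toda _ _ hP t n ht; have dn1 := family_toda _ _ hP t n.+1 ht.
have dB := is_deriveD dn dn1.
split; first by case: dB.
have -> : (fun s => B n s + B n.+1 s)^`()%classic t =
    (Zcoef P n t - Zcoef P n.+1 t) / t + (Zcoef P n.+1 t - Zcoef P n.+2 t) / t.
  by rewrite derive1E; case: dB.
rewrite -mulrDl mulrC divfK ?gt_eqF//.
have := family_first _ _ hP t n ht; have := family_first _ _ hP t n.+1 ht.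
rewrite /rcoef -/(B n t) -/(B n.+1 t) -natr1; lra.
Qed.
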